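(* Let $G$ be a finite abelian group and let $m_1, \dots, m_t$ be positive integers such that $G$ is isomorphic to $\bigoplus_{i=1}^t C_{m_i}$. Then \[ \sum_{i=1}^t \lfloor \log_2 m_i \rfloor + 1 \le \mathsf{D}_{\pm}(G) \le \Big\lfloor \sum_{i=1}^t \log_2 m_i \Big\rfloor + 1. \]
   Context: $C_m$ denotes a cyclic group of order $m$; the $m_i$ are not required to form a chain of divisors. For a finite abelian group $G$ (written additively), the plus-minus weighted Davenport constant $\mathsf{D}_{\pm}(G)$ is the smallest positive integer $\ell$ such that for every sequence $g_1,\dots,g_k$ of elements of $G$ (repetitions allowed) with $k \ge \ell$ there exist a non-empty subset $I \subset \{1,\dots,k\}$ and $a_i \in \{+1,-1\}$ ($i\in I$) with $\sum_{i \in I} a_i g_i = 0$. *)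

(* Defs.v *)
From HB Require Import structures.
From mathcomp Require Import all_boot all_order all_algebra all_fingroup.
From mathcomp Require Import boolp reals exp.

Set Implicit Arguments.
Unset Strict Implicit.
Unset Printing Implicit Defensive.

Import Order.TTheory GRing.Theory Num.Theory.

Local Open Scope ring_scope.

Definition log2 (R : realType) (x : R) : R := ln x / ln 2.

(* 'I_n is a group (the integers mod n) only for n syntactically a successor;
   for m > 0, m.-1.+1 = m. *)
Definition cyc (m : nat) : finZmodType := 'I_m.-1.+1.

(* The external direct sum of the C_{m_i}: dependent finite functions, with the
   pointwise group law. *)
Definition direct_sum_cyc (t : nat) (m : 'I_t -> nat) : finGroupType :=
  {dffun forall i : 'I_t, cyc (m i)}.

Definition has_pm_zero_subsum (G : finZmodType) (k : nat) (g : 'I_k -> G) :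
    Prop :=
  exists (I : {set 'I_k}) (a : 'I_k -> int),
    [/\ I != set0,
        forall i, i \in I -> a i = 1 \/ a i = -1 &
        \sum_(i in I) g i *~ a i = 0].

Definition pm_davenport_bound (G : finZmodType) (l : nat) : Prop :=
  forall (k : nat) (g : 'I_k -> G), (l <= k)%N -> has_pm_zero_subsum g.

Lemma pm_davenport_bound_exists (G : finZmodType) :
  exists l : nat, (0 < l)%N && `[< pm_davenport_bound G l >].
Proof.
exists #|G|.+1; apply/andP; split=> //; apply/asboolP => k g ltGk.
have /injectivePn[i [j neq_ij eq_g]] : ~~ injectiveb g.
  apply/negP => /injectiveP/leq_card; rewrite card_ord => leqkG.
  by move: ltGk; rewrite ltnNge leqkG.
exists [set i; j], (fun x => if x == i then 1 else -1); split.
- by apply/set0Pn; exists i; rewrite set21.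
- by move=> x _; case: ifP; [left | right].
- rewrite big_setU1 ?inE //= big_set1 eqxx eq_sym (negbTE neq_ij).
  by rewrite mulrNz mulr1z eq_g subrr.
Qed.

Definition pm_davenport (G : finZmodType) : nat :=
  ex_minn (pm_davenport_bound_exists G).

(* Main.v *)
(* Upper bound: if 2 ^ k > #|G|, two distinct subsets of the index set of a
   sequence of length k have the same sum; subtracting these sums cancels the
   common terms and leaves a nonempty signed zero-sum on the symmetric
   difference. Lower bound: in each C_(m_i) with generator e_i, take the
   elements 2 ^ j e_i for 2 ^ j.+1 <= m_i; a combination of them with
   coefficients in {-1, 0, 1} is N e_i with |N| < m_i, and N = 0 forces all
   the coefficients to vanish, as one sees by reducing mod 2. *)

From HB Require Import structures.
Require Import Defs.
From mathcomp Require Import all_boot all_order all_algebra all_fingroup.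
From mathcomp Require Import boolp reals exp.
From mathcomp Require Import zify.

Import Order.TTheory GRing.Theory Num.Theory.

Local Open Scope ring_scope.

(** Removes the real logarithms from both bounds: what remains is about [trunc_log 2] of the [m i]
    and of their product, which is the order of [G]. *)
Lemma floor_log2_nat {R : realType} (n : nat) :
  (0 < n)%N -> Num.floor (log2 (n%:R : R)) = (trunc_log 2 n)%:Z.
Proof.
move=> n_gt0; have ln2 : 0 < ln (2 : R) by rewrite ln_gt0 // ltr1n.
have pos k : (0 < k)%N -> (k%:R : R) \is Num.pos by rewrite posrE ltr0n.
have /andP[len ltn] := trunc_log_bounds (isT : (1 < 2)%N) n_gt0.
have lnX k : k%:R * ln (2 : R) = ln ((2 ^ k)%N%:R).
  by rewrite natrX lnXn // mulr_natl.
apply: floor_def; rewrite /log2 ler_pdivlMr // ltr_pdivrMr //.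
rewrite -PoszD !pmulrn !lnX.
rewrite ler_ln ?ltr_ln ?pos ?expn_gt0 // ler_nat ltr_nat len /=.
by rewrite addn1.
Qed.

Lemma sum_log2_nat (R : realType) (t : nat) (m : 'I_t -> nat) :
  (forall i, (0 < m i)%N) ->
  \sum_(i < t) log2 ((m i)%:R : R) = log2 ((\prod_(i < t) m i)%N%:R).
Proof.
move=> m_gt0; rewrite /log2 -mulr_suml; congr (_ / _).
suff [] : \sum_(i < t) ln ((m i)%:R : R) = ln ((\prod_(i < t) m i)%N%:R) /\
  (0 < \prod_(i < t) m i)%N by [].
apply: (big_ind2 (fun x n => x = ln (n%:R : R) /\ (0 < n)%N)) => //.
  by rewrite ln1.
move=> x a y b [-> a_gt0] [-> b_gt0]; split; last by rewrite muln_gt0 a_gt0.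
by rewrite natrM lnM // posrE ltr0n.
Qed.

Lemma card_direct_sum_cyc (t : nat) (m : 'I_t -> nat) :
  (forall i, (0 < m i)%N) -> #|direct_sum_cyc m| = (\prod_(i < t) m i)%N.
Proof.
move=> m_gt0; rewrite card_dep_ffun foldrE big_map big_enum /=.
by apply: eq_bigr => i _; rewrite card_ord prednK.
Qed.

Lemma pm_davenport_leP (G : finZmodType) (l : nat) :
  (0 < l)%N -> pm_davenport_bound G l -> (pm_davenport G <= l)%N.
Proof.
move=> l_gt0 Gl; rewrite /pm_davenport; case: ex_minnP => k _; apply.
by rewrite l_gt0; apply/asboolP.
Qed.

Lemma pm_davenportP (G : finZmodType) : pm_davenport_bound G (pm_davenport G).
Proof. by rewrite /pm_davenport; case: ex_minnP => k /andP[_ /asboolP]. Qed.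

Lemma pm_davenport_bound_trunc_log (G : finZmodType) :
  pm_davenport_bound G (trunc_log 2 #|G|).+1.
Proof.
move=> k g ltk.
pose S (A : {set 'I_k}) := \sum_(i in A) g i.
have /injectivePn[A [B neqAB eqS]] : ~~ injectiveb S.
  apply/negP => /injectiveP/leq_card.
  rewrite -cardsT -powersetT card_powerset cardsT card_ord leqNgt.
  by rewrite (leq_trans (trunc_log_ltn #|G| (isT : (1 < 2)%N))) // leq_exp2l.
exists ((A :\: B) :|: (B :\: A)), (fun i => if i \in A then 1 else -1); split.
- apply: contraNneq neqAB => /eqP; rewrite setU_eq0 !setD_eq0 => /andP[AB BA].
  by rewrite eqEsubset AB.
- by move=> i _; case: ifP; [left | right].
- rewrite (eq_bigl [predU A :\: B & B :\: A]); last by move=> i; rewrite !inE.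
  rewrite bigU /=; last first.
    by rewrite -setI_eq0; apply/eqP/setP => i; rewrite !inE; do 2!case: (_ \in _).
  rewrite (eq_bigr g); last by move=> i /setDP[-> _].
  rewrite [X in _ + X](eq_bigr (fun i => - g i)); last first.
    by move=> i /setDP[_ /negbTE->]; rewrite mulrNz mulr1z.
  rewrite sumrN; apply/eqP; rewrite subr_eq0; apply/eqP.
  (* Both subset sums contain the sum over [A :&: B]; cancelling it equates the sums over the two
     differences. *)
  by move: eqS; rewrite /S (big_setID B) [RHS](big_setID A) /= setIC => /addrI.
Qed.

(** Coefficient 0 marks the indices outside the chosen subset, so a signed subsum becomes a full sum
    with coefficients in {-1, 0, 1}. Allowing any finite index type serves the lower bound, whose
    sequence is indexed by pairs. *)
Lemma pm_davenport_le_card (G : finZmodType) (K : finType) (g : K -> G) :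
  (pm_davenport G <= #|K|)%N ->
  exists c : K -> int,
    [/\ forall x, `|c x| <= 1, exists x, c x != 0 & \sum_x g x *~ c x = 0].
Proof.
move=> leGK.
have [I [a [/set0Pn[i Ii] a1 sum0]]] := pm_davenportP G #|K| (g \o enum_val) leGK.
exists (fun x => if enum_rank x \in I then a (enum_rank x) else 0); split.
- by move=> x; case: ifP => // /a1[] ->.
- by exists (enum_val i); rewrite enum_valK Ii; case: (a1 i Ii) => ->.
- rewrite (reindex (@enum_val K predT)) /=; last exact: onW_bij (enum_val_bij _).
  rewrite -[RHS]sum0 [RHS]big_mkcond; apply: eq_bigr => j _ /=.
  by rewrite enum_valK; case: ifP.
Qed.

(** The extreme case is 1 + 2 + ... + 2^(L-1) = 2^L - 1. *)
Lemma norm_binary_sum_lt (L : nat) (c : 'I_L -> int) :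
  (forall j, `|c j| <= 1) -> `|\sum_(j < L) (2 ^ j)%N%:Z * c j| < (2 ^ L)%N%:Z.
Proof.
elim: L c => [|L IH] c c1; first by rewrite big_ord0.
rewrite big_ord_recr /=.
have /= := IH _ (fun j => c1 (widen_ord (leqnSn L) j)).
have : c ord_max \in [:: -1; 0; 1] by have := c1 ord_max; rewrite !inE; lia.
rewrite !inE expnS; set S := \sum_(_ < _) _; set x := (2 ^ L)%N.
by move=> /or3P[] /eqP->; lia.
Qed.

Lemma binary_sum_eq0 (L : nat) (c : 'I_L -> int) :
  (forall j, `|c j| <= 1) -> \sum_(j < L) (2 ^ j)%N%:Z * c j = 0 ->
  forall j, c j = 0.
Proof.
elim: L c => [|L IH] c c1; first by move=> _ [].
rewrite big_ord_recl /=.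
rewrite (eq_bigr (fun j : 'I_L => 2 * ((2 ^ j)%N%:Z * c (lift ord0 j)))).
  rewrite -mulr_sumr expn0; set S := \sum_(_ < _) _ => sum0.
  (* Here [c ord0 + 2 * S = 0], so [c ord0] is even and of absolute value at most 1. *)
  have [c00 S0] : c ord0 = 0 /\ S = 0 by have := c1 ord0; lia.
  move=> j; have [j'|] := unliftP ord0 j => ->//.
  exact: (IH _ (fun j => c1 (lift ord0 j)) S0 j').
by move=> j _; rewrite /= /bump /= expnS PoszM mulrA.
Qed.

Lemma Zp_generator_mulrz_eq0 (n : nat) (N : int) :
  (inZp 1 : 'I_n.+1) *~ N = 0 -> `|N| < n.+1%:Z -> N = 0.
Proof.
have nat_case k : (inZp 1 : 'I_n.+1) *+ k = 0 -> (k < n.+1)%N -> k = 0%N.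
  rewrite Zp_mulrn => /(congr1 val) /=.
  by rewrite modnMml mul1n => + ltk; rewrite modn_small.
case: (intP N) => [|k|k] //; first by move=> /nat_case/[apply]->.
move/eqP; rewrite mulrNz oppr_eq0 normrN => /eqP/nat_case/[apply]; lia.
Qed.

Lemma sum_trunc_log_lt_pm_davenport (G : finZmodType) (t : nat)
    (m : 'I_t -> nat) :
  (forall i, (0 < m i)%N) -> [set: G] \isog [set: direct_sum_cyc m] ->
  (\sum_(i < t) trunc_log 2 (m i) < pm_davenport G)%N.
Proof.
move=> m_gt0 /isogP[f injf imf]; rewrite ltnNge; apply/negP.
(* Pairs (i, j) with 2^(j+1) <= m_i; the sequence [g] consists of the preimages under [f] of the
   elements 2^j e_i. *)
pose K := {i : 'I_t & 'I_(trunc_log 2 (m i))}.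
have -> : (\sum_(i < t) trunc_log 2 (m i))%N = #|{: K}|.
  rewrite card_tagged sumnE big_map big_enum /=.
  by apply: eq_bigr => i _; rewrite card_ord.
have /fin_all_exists[g fg] (s : K) : exists x : G,
    f x = dfung1 ((inZp 1 : cyc (m (tag s))) *+ (2 ^ tagged s)).
  have: dfung1 ((inZp 1 : cyc (m (tag s))) *+ (2 ^ tagged s)) \in
      (f @* [set: G])%g.
    by rewrite imf inE.
  by case/morphimP => x _ _ ->; exists x.
move=> /(pm_davenport_le_card G K g)[c [c1 [[i j]]]] + sum0.
(* The coefficient at (i, j) was nonzero; projecting the relation to coordinate i shows that it
   vanishes. *)
apply/negP; rewrite negbK.
pose p (x : G) : cyc (m i) := f x i.
have pB : zmod_morphism p.
  (* The additive law of [G] is convertible to the group law that [f] respects. *)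
  move=> x y; rewrite /p -[x - y]/(x * y^-1)%g morphM ?inE // morphV ?inE //.
  by rewrite mulg_ffun invg_ffun.
pose pA : {additive G -> cyc (m i)} :=
  HB.pack p (GRing.isZmodMorphism.Build _ _ p pB).
have {sum0} : pA (\sum_s g s *~ c s) = 0 by rewrite sum0 raddf0.
have pg k (l : 'I_(trunc_log 2 (m k))) :
    pA (g (Tagged _ l)) =
    (dfung1 ((inZp 1 : cyc (m k)) *+ (2 ^ l)) : direct_sum_cyc m) i.
  by rewrite /= /p fg.
rewrite raddf_sum.
have -> : \sum_s pA (g s *~ c s) =
    \sum_k \sum_(l < trunc_log 2 (m k)) pA (g (Tagged _ l)) *~ c (Tagged _ l).
  by rewrite sig_big_dep; apply: eq_bigr => -[k l] _; rewrite raddfMz.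
(* Only the terms of block i have a nonzero i-th coordinate. *)
rewrite (bigD1 i) //= [X in _ + X]big1 ?addr0; last first.
  move=> k neq_ki; apply: big1 => l _.
  by rewrite [p _]pg dfung1_dflt // mul0rz.
under eq_bigr => l _ do rewrite [p _]pg dfung1_id pmulrn -mulrzA.
rewrite -mulrz_sumr => /Zp_generator_mulrz_eq0 sum0.
have ci1 l : `|c (Tagged _ l : K)| <= 1 by apply: c1.
apply/eqP; apply: (binary_sum_eq0 _ (fun l => c (Tagged _ l))) => //.
apply: sum0; rewrite prednK //.
(* The integer multiplying e_i is below 2^L <= m_i in absolute value, with L =
   [trunc_log 2 (m i)]. *)
apply: lt_le_trans (norm_binary_sum_lt _ _ _) _ => //.
by rewrite lez_nat trunc_logP.
Qed.

Theorem theorem3p1 (R : realType) (G : finZmodType) (t : nat)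
    (m : 'I_t -> nat) (m_gt0 : forall i, (0 < m i)%N)
    (isoG : [set: G] \isog [set: direct_sum_cyc m]) :
  \sum_(i < t) Num.floor (log2 ((m i)%:R : R)) + 1 <= (pm_davenport G)%:Z
  /\ (pm_davenport G)%:Z <= Num.floor (\sum_(i < t) log2 ((m i)%:R : R)) + 1.
Proof.
have cardG : #|G| = (\prod_(i < t) m i)%N.
  by rewrite -cardsT (card_isog isoG) cardsT card_direct_sum_cyc.
split.
  rewrite (eq_bigr (fun i => (trunc_log 2 (m i))%:Z)); last first.
    by move=> i _; rewrite floor_log2_nat.
  rewrite -(big_morph Posz PoszD (erefl 0%:Z)) -PoszD lez_nat addn1.
  exact: sum_trunc_log_lt_pm_davenport.
rewrite sum_log2_nat // floor_log2_nat; last by rewrite prodn_gt0.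
rewrite -PoszD lez_nat addn1 -cardG.
by apply: pm_davenport_leP => //; apply: pm_davenport_bound_trunc_log.
Qed.
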